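(* Let $p<q$ and let $\rho:\Gamma\to \mathrm{SO}(p,q)$ be $\Theta$-positive Anosov. For every $1\leq k\leq p-3$ the representation $\rho$ has property $C_k$.
   Context: $\Gamma$ is the fundamental group of a closed orientable surface of genus at least $2$, $\partial\Gamma$ (a topological circle, with a fixed orientation) its Gromov boundary. Representations into $\mathrm{SO}(p,q)$ are regarded as representations into $\mathrm{SL}(E)$ with $E=\mathbb R^{d}$, $d=p+q$. Anosov: fix a word metric $|\cdot|_\Gamma$ and let $\sigma_1(A)\ge\dots\ge\sigma_d(A)$ be the singular values of $A\in\mathrm{SL}(E)$. For $1\le j\le d-1$, $\rho:\Gamma\to \mathrm{SL}(E)$ is $j$-Anosov if there are $c,\mu>0$ with $\frac{\sigma_j}{\sigma_{j+1}}(\rho(\gamma))\ge ce^{\mu|\gamma|_\Gamma}$ for all $\gamma$. This is equivalent to being $(d-j)$-Anosov. ''$S$-Anosov'' for a finite set $S$ means $j$-Anosov for all $j\in S$, $0$-Anosov and $d$-Anosov being empty conditions. A $j$-Anosov representation has continuous, $\rho$-equivariant, transverse ($\xi^j(x)\oplus\xi^{d-j}(y)=E$ for $x\neq y$), dynamics preserving boundary maps $\xi^j:\partial\Gamma\to\mathrm{Gr}_j(E)$, $\xi^{d-j}:\partial\Gamma\to\mathrm{Gr}_{d-j}(E)$; write $x^j:=\xi^j(x)$, $x^0=\{0\}$, $x^d=E$. Property $C_k$ ($1\le k\le d-2$): $\rho$ is $\{k-1,k,k+1,k+2\}$-Anosov and for all pairwise distinct $x,y,z\in\partial\Gamma$ the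 sum $x^{d-k-2}+(y^k\cap x^{d-k+1})+z^{k+1}$ is direct. $\Theta$-positive (Anosov) representations into $\mathrm{SO}(p,q)$, $3\le p<q$: choose a basis $e_1,\dots,e_d$ of $\mathbb R^{p+q}$ in which the form $Q$ of signature $(p,q)$ has matrix $\begin{pmatrix}0&0&K\\0&J&0\\ K^t&0&0\end{pmatrix}$, where $K$ is the $(p-1)\times(p-1)$ antidiagonal matrix with alternating entries $\pm1$, lower-left entry $-1$ and upper-right entry $(-1)^{p-1}$, and $J=\begin{pmatrix}0&0&1\\0&-\mathrm{Id}_{q-p}&0\\1&0&0\end{pmatrix}$. Let $\mathcal F$ be the set of partial flags with subspaces of dimensions $1,\dots,p-1,q+1,\dots,q+p-1$ whose first $p-1$ subspaces are $Q$-isotropic and whose others are their $Q$-orthogonals. Let $Z,X\in\mathcal F$ be given by $Z^l=\langle e_1,\dots,e_l\rangle$, $X^l=\langle e_d,\dots,e_{d-l+1}\rangle$. For $1\le j\le p-2$ and $v>0$, $E_j(v)$ is the matrix differing from the identity only in positions $(j,j+1)$ and $(d-j,d-j+1)$, where it equals $v$. For $v\in c_J(\mathbb R^{q-p+2}):=\{v: v^tJv>0,\ \text{first entry of }v\text{ positive}\}$, $$E_{p-1}(v)=\begin{pmatrix}\mathrm{Id}_{p-2}&0&0&0&0\\0&1&v^t&q_J(v)&0\\0&0&\mathrm{Id}_{q-p+2}&Jv&0\\0&0&0&1&0\\0&0&0&0&\mathrm{Id}_{p-2}\end{pmatrix},\qquad q_J(v)=\tfrac12v^tJv.$$ Let $V_\Theta=\{(v_1,\dots,v_{p-1}):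 v_1,\dots,v_{p-2}\in\mathbb R_{>0},\ v_{p-1}\in c_J(\mathbb R^{q-p+2})\}$; for $\bar v\in V_\Theta$ let $ab(\bar v)=\big(\prod_{j\le p-1,\,j\text{ even}}E_j(v_j)\big)\big(\prod_{j\le p-1,\,j\text{ odd}}E_j(v_j)\big)$. With $h=2(p-1)$ the Coxeter number of $B_{p-1}$, the positive elements are $P(\bar v_1,\dots,\bar v_{h/2})=ab(\bar v_1)\cdots ab(\bar v_{h/2})$, $\bar v_i\in V_\Theta$. A triple $(A,B,C)\in\mathcal F^3$ is $\Theta$-positive if there are $g\in\mathrm{SO}_0(p,q)$ and a positive element $P$ with $(gA,gB,gC)=(X,PX,Z)$. A representation $\rho:\Gamma\to\mathrm{SO}(p,q)$ is $\Theta$-positive (Anosov) if it is $\{1,\dots,p-1\}$-Anosov and its equivariant boundary map $\xi:\partial\Gamma\to\mathcal F$ is positive: for every positively oriented triple $(z,y,x)$ in $\partial\Gamma$ the triple $(\xi(z),\xi(y),\xi(x))$ is $\Theta$-positive. *)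

(* Defs.v *)
From HB Require Import structures.
From mathcomp Require Import all_boot all_order all_algebra.
From mathcomp Require Import all_classical all_reals all_analysis.

Set Implicit Arguments.
Unset Strict Implicit.
Unset Printing Implicit Defensive.

Import Order.TTheory GRing.Theory Num.Theory.
Import numFieldNormedType.Exports.

Local Open Scope classical_set_scope.
Local Open Scope ring_scope.

(** * Surface groups *)

(* Letters of the surface relator: [(i, false, e)] stands for a_i and
   [(i, true, e)] for b_i; [e = true] denotes the inverse letter. *)
Definition letter (g : nat) : Type := ('I_g * bool * bool)%type.

Definition letterV g (l : letter g) : letter g := (l.1, ~~ l.2).

(* prod_i a_i b_i a_i^-1 b_i^-1 *)
Definition surface_relator g : seq (letter g) :=
  flatten [seq [:: (i, false, false); (i, true, false);
                   (i, false, true); (i, true, true)] | i <- enum 'I_g].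

(* Equality of words in
   < a_1, b_1, ..., a_g, b_g | prod_i [a_i, b_i] >. *)
Inductive surface_eq g : seq (letter g) -> seq (letter g) -> Prop :=
| surface_eq_refl w : surface_eq w w
| surface_eq_sym w1 w2 : surface_eq w1 w2 -> surface_eq w2 w1
| surface_eq_trans w1 w2 w3 :
    surface_eq w1 w2 -> surface_eq w2 w3 -> surface_eq w1 w3
| surface_eq_cancel u l v : surface_eq (u ++ [:: l; letterV l] ++ v) (u ++ v)
| surface_eq_relator u v : surface_eq (u ++ surface_relator g ++ v) (u ++ v).

Definition eval_word g (Gamma : groupType) (f : 'I_g * bool -> Gamma)
    (w : seq (letter g)) : Gamma :=
  (\prod_(l <- w) (if l.2 then (f l.1)^-1 else f l.1))%g.

Definition is_surface_group (g : nat) (Gamma : groupType) : Prop :=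
  exists f : 'I_g * bool -> Gamma,
    (forall x, exists w, eval_word f w = x) /\
    (forall w1 w2, eval_word f w1 = eval_word f w2 <-> surface_eq w1 w2).

(** * Word metric and Gromov boundary *)

Section Boundary.
Variables (Gamma : groupType) (S : seq Gamma).
Implicit Types (x y : Gamma) (n : nat).

Definition word_ball n x : Prop :=
  exists w : seq Gamma,
    [/\ (size w <= n)%N, {in w, forall s, (s \in S) || (s^-1 \in S)%g}
      & x = (\prod_(s <- w) s)%g].

Definition generates : Prop := forall x, exists n, word_ball n x.

Definition word_length x : nat :=
  xget 0%N [set n | word_ball n x /\ forall m, word_ball m x -> (n <= m)%N].

(* Geodesic rays (with arbitrary origin) of the Cayley graph of Gamma with
   respect to S, for the left-invariant metric d(x, y) = |x^-1 y|. *)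
Record georay := GeoRay {
  ray_fun :> nat -> Gamma;
  ray_geodesic : forall m n, (m <= n)%N ->
    word_length ((ray_fun m)^-1 * ray_fun n)%g = (n - m)%N }.

HB.instance Definition _ := gen_eqMixin georay.
HB.instance Definition _ := gen_choiceMixin georay.

Definition asymptotic (r s : georay) : bool :=
  `[< exists C, forall n, word_ball C ((r n)^-1 * s n)%g >].

Lemma asymptotic_refl : reflexive asymptotic.
Proof.
move=> r; apply/asboolP; exists 0%N => n; exists [::].
by split; rewrite ?big_nil ?mulVg.
Qed.

Lemma word_ballV n x : word_ball n x -> word_ball n (x^-1)%g.
Proof.
case=> w [sw wS ->]; exists (rev (map (fun s => s^-1)%g w)); split.
- by rewrite size_rev size_map.
- move=> s; rewrite mem_rev => /mapP[t tw ->].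
  by rewrite invgK orbC wS.
- elim: w {sw wS} => [|s w IH]; first by rewrite !big_nil invg1.
  by rewrite big_cons invgM IH /= rev_cons -cats1 big_cat big_seq1.
Qed.

Lemma word_ballM n m x y :
  word_ball n x -> word_ball m y -> word_ball (n + m) (x * y)%g.
Proof.
case=> w [sw wS ->] [w' [sw' w'S ->]]; exists (w ++ w'); split.
- by rewrite size_cat leq_add.
- by move=> s; rewrite mem_cat => /orP[/wS|/w'S].
- by rewrite big_cat.
Qed.

Lemma asymptotic_sym : symmetric asymptotic.
Proof.
have H r s : asymptotic r s -> asymptotic s r.
  move=> /asboolP[C rs]; apply/asboolP; exists C => n.
  by have := word_ballV (rs n); rewrite invgM invgK.
by move=> r s; apply/idP/idP; apply: H.
Qed.

Lemma asymptotic_trans : transitive asymptotic.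
Proof.
move=> s r t /asboolP[C rs] /asboolP[D st]; apply/asboolP.
exists (C + D)%N => n; have := word_ballM (rs n) (st n).
by rewrite mulgA mulgK.
Qed.

Canonical asymptotic_equiv :=
  EquivRel asymptotic asymptotic_refl asymptotic_sym asymptotic_trans.

Definition boundary : Type := {eq_quot asymptotic}%qT.
HB.instance Definition _ := Choice.on boundary.
HB.instance Definition _ := Quotient.on boundary.

Definition endpoint (r : georay) : boundary := \pi_(boundary)%qT r.

(* Quotient topology of the topology of uniform convergence on compact sets:
   two rays are close when they coincide on a long initial segment. *)
Definition boundary_open (U : set boundary) : Prop :=
  forall r, U (endpoint r) -> exists N, forall s : georay,
    (forall n, (n <= N)%N -> s n = r n) -> U (endpoint s).

Lemma boundary_openT : boundary_open setT.
Proof. by move=> r _; exists 0%N. Qed.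

Lemma boundary_openI : setI_closed boundary_open.
Proof.
move=> U V oU oV r [/oU[N HN] /oV[M HM]]; exists (maxn N M) => s rs.
by split; [apply: HN | apply: HM] => n nN; apply: rs; rewrite leq_max nN ?orbT.
Qed.

Lemma boundary_open_bigU (I : Type) (f : I -> set boundary) :
  (forall i, boundary_open (f i)) -> boundary_open (\bigcup_i f i).
Proof.
move=> of_ r [i _ fir]; have [N HN] := of_ i r fir.
by exists N => s rs; exists i => //; apply: HN.
Qed.

HB.instance Definition _ := isOpenTopological.Build boundary
  boundary_openT boundary_openI boundary_open_bigU.

Lemma translate_geodesic x (r : georay) m n : (m <= n)%N ->
  word_length ((x * r m)^-1 * (x * r n))%g = (n - m)%N.
Proof. by move=> mn; rewrite invgM mulgA mulgVK ray_geodesic. Qed.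

Definition translate x (r : georay) : georay :=
  GeoRay (@translate_geodesic x r).

Definition boundary_act x (b : boundary) : boundary :=
  endpoint (translate x (repr b)).

End Boundary.

(** * Orientations of the boundary circle *)

Section Orientation.
Variables (R : realType) (T : topologicalType).

Definition unit_circle : set (R * R) := [set u | u.1 ^+ 2 + u.2 ^+ 2 = 1].

(* [theta] is a homeomorphism from T onto the unit circle (with the topology
   induced by R^2); it carries an orientation of T, the pullback of the
   counterclockwise one. *)
Definition circle_homeo (theta : T -> R * R) : Prop :=
  [/\ continuous theta, injective theta, range theta = unit_circle &
      forall U : set T, open U ->
        exists2 V : set (R * R), open V & theta @` U = V `&` unit_circle].

(* The points theta x, theta y, theta z of the unit circle are met in this
   order counterclockwise iff det (theta y - theta x, theta z - theta x) > 0. *)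
Definition positively_oriented (theta : T -> R * R) (x y z : T) : Prop :=
  0 < ((theta y).1 - (theta x).1) * ((theta z).2 - (theta x).2)
    - ((theta y).2 - (theta x).2) * ((theta z).1 - (theta x).1).

End Orientation.

(* f^n converges to x, uniformly on some neighbourhood of the fixed point x. *)
Definition attracting_fixpoint (T : topologicalType) (f : T -> T) (x : T) :
    Prop :=
  f x = x /\
  exists2 U, nbhs x U & forall V, nbhs x V -> exists N, forall n, (N <= n)%N ->
    forall y, U y -> V (iter n f y).

(** * Grassmannians *)

Section Grassmannian.
Variables (R : realType) (d : nat).

(* The disjoint union of the Grassmannians Gr_j(R^d), 0 <= j <= d. A subspace
   is represented by the canonical matrix with that row space. *)
Record grass := Grass { grass_mx :> 'M[R]_d; _ : (<<grass_mx>>%MS == grass_mx) }.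
HB.instance Definition _ := [isSub for grass_mx].
HB.instance Definition _ := [Choice of grass by <:].

Lemma rowspan_subproof m (A : 'M[R]_(m, d)) : (<<(<<A>>)>>%MS == <<A>>%MS).
Proof. by rewrite genmx_id. Qed.

Definition rowspan m (A : 'M[R]_(m, d)) : grass := Grass (rowspan_subproof A).

(* Topology: Gr_j is the quotient of the space of j x d matrices of rank j. *)
Definition grass_open (U : set grass) : Prop :=
  forall j (A : 'M[R]_(j, d)), row_free A -> U (rowspan A) ->
    \forall B \near A, row_free B -> U (rowspan B).

Lemma grass_openT : grass_open setT.
Proof. by move=> j A _ _; apply: filterE => B. Qed.

Lemma grass_openI : setI_closed grass_open.
Proof.
move=> U V oU oV j A fA [UA VA].
by apply: filterS2 (oU j A fA UA) (oV j A fA VA) => B hU hV fB; split; auto.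
Qed.

Lemma grass_open_bigU (I : Type) (f : I -> set grass) :
  (forall i, grass_open (f i)) -> grass_open (\bigcup_i f i).
Proof.
move=> of_ j A fA [i _ fiA].
by apply: filterS (of_ i j A fA fiA) => B h fB; exists i => //; apply: h.
Qed.

HB.instance Definition _ := isOpenTopological.Build grass
  grass_openT grass_openI grass_open_bigU.

(* Matrices act on column vectors, and the rows of V are the transposes of
   spanning vectors: hence the transpose. *)
Definition grass_act (g : 'M[R]_d) (V : grass) : grass := rowspan (V *m g^T).

End Grassmannian.

(** * Anosov representations and property C_k *)

Section Anosov.
Variables (R : realType) (d : nat).

Definition is_singular_values (A : 'M[R]_d) (s : seq R) : Prop :=
  [/\ size s = d, sorted >=%R s, all (>= 0) s
    & char_poly (A^T *m A) = \prod_(x <- s) ('X - (x ^+ 2)%:P)].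

(* sigma_1 >= ... >= sigma_d: the index starts at 1. *)
Definition singular_value (j : nat) (A : 'M[R]_d) : R :=
  nth 0 (xget [::] [set s | is_singular_values A s]) j.-1.

Variables (Gamma : groupType) (S : seq Gamma) (rho : Gamma -> 'M[R]_d).

Definition anosov (j : nat) : Prop :=
  (0 < j < d)%N ->
  exists c mu : R, [/\ 0 < c, 0 < mu & forall x,
    singular_value j (rho x) / singular_value j.+1 (rho x)
      >= c * expR (mu * (word_length S x)%:R)].

Definition anosov_on (J : seq nat) : Prop := {in J, forall j, anosov j}.

Definition limit_map (j : nat) (xi : boundary S -> grass R d) : Prop :=
  [/\ forall b, \rank (xi b) = j,
      continuous xi,
      forall x b, xi (boundary_act x b) = grass_act (rho x) (xi b)
    & forall x b, attracting_fixpoint (boundary_act x) b ->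
        attracting_fixpoint (grass_act (rho x)) (xi b)].

(* [xi j] and [xi (d - j)] are the boundary maps of the j-Anosov
   representation [rho]. For j = 0 and j = d the dimension requirement forces
   the convention x^0 = 0, x^d = R^d. *)
Definition limit_maps (j : nat) (xi : nat -> boundary S -> grass R d) : Prop :=
  [/\ limit_map j (xi j), limit_map (d - j)%N (xi (d - j)%N)
    & forall x y, x <> y ->
        mxdirect (xi j x + xi (d - j)%N y)%MS /\
        (xi j x + xi (d - j)%N y :=: 1%:M)%MS].

(* The boundary maps are determined by [rho] (by continuity, equivariance and
   their values at attracting fixed points), so [exists xi] just names them. *)
Definition property_C (k : nat) : Prop :=
  let J := [:: k.-1; k; k.+1; k.+2] in
  anosov_on J /\
  exists xi : nat -> boundary S -> grass R d,
    {in J, forall j, limit_maps j xi} /\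
    forall x y z, x <> y -> y <> z -> x <> z ->
      mxdirect (xi (d - k - 2)%N x
                + (xi k y :&: xi (d - k + 1)%N x)
                + xi k.+1 z)%MS.

End Anosov.

(** * Theta-positivity in SO(p,q) *)

(* Below, matrix indices are 0-based whereas flag dimensions and the indices
   of the E_j are 1-based. *)

Section ThetaPositive.
Variables (R : realType) (p q : nat).
Local Notation d := (p + q)%N.

(* The antidiagonal (p-1) x (p-1) matrix K, as a function of 0-based indices. *)
Definition Kentry (i j : nat) : R :=
  if (i + j == p - 2)%N then (-1) ^+ (p - 1 - i) else 0.

Definition Jmx : 'M[R]_((q - p).+2) := \matrix_(i, j)
  if (i == ord0) && (j == ord_max) || (i == ord_max) && (j == ord0) then 1
  else if (i == j) && (i != ord0) && (i != ord_max) then -1 else 0.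

(* The form of signature (p, q), in blocks of sizes p - 1, q - p + 2, p - 1:
   R^{p+q} is identified with R^d through the basis e_1, ..., e_d in which the
   form has this matrix. *)
Definition Qmx : 'M[R]_d := \matrix_(i, j)
  if (i < p - 1)%N then
    if (q < j)%N then Kentry i (j - (q + 1)) else 0
  else if (i <= q)%N then
    if (p - 1 <= j <= q)%N
    then Jmx (inord (i - (p - 1))) (inord (j - (p - 1))) else 0
  else if (j < p - 1)%N then Kentry j (i - (q + 1)) else 0.

Definition SO : set 'M[R]_d :=
  [set g | g^T *m Qmx *m g = Qmx /\ \det g = 1].

Definition SO0 : set 'M[R]_d := connected_component SO 1%:M.

Definition qJ (v : 'cV[R]_((q - p).+2)) : R := 2^-1 * (v^T *m Jmx *m v) 0 0.

Definition cJ (v : 'cV[R]_((q - p).+2)) : Prop :=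
  0 < (v^T *m Jmx *m v) 0 0 /\ 0 < v ord0 0.

(* E_j(v), 1 <= j <= p - 2 *)
Definition Emx (j : nat) (v : R) : 'M[R]_d := \matrix_(a, b)
  if (a.+1 == j) && (b == j :> nat) || (a.+1 == d - j)%N && (b == d - j :> nat)%N
  then v else (a == b)%:R.

(* E_{p-1}(v) *)
Definition Elast (v : 'cV[R]_((q - p).+2)) : 'M[R]_d := \matrix_(a, b)
  if (a == p - 2 :> nat)%N && (p - 1 <= b <= q)%N then
    v (inord (b - (p - 1))) 0
  else if (a == p - 2 :> nat)%N && (b == q + 1 :> nat)%N then qJ v
  else if (p - 1 <= a <= q)%N && (b == q + 1 :> nat)%N then
    (Jmx *m v) (inord (a - (p - 1))) 0
  else (a == b)%:R.

(* (v_1, ..., v_{p-2}; v_{p-1}); the values of the first component outside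
   {1, ..., p-2} are irrelevant. *)
Definition theta_param : Type := ((nat -> R) * 'cV[R]_((q - p).+2))%type.

Definition V_Theta (v : theta_param) : Prop :=
  (forall j, (1 <= j <= p - 2)%N -> 0 < v.1 j) /\ cJ v.2.

Definition Etheta (v : theta_param) (j : nat) : 'M[R]_d :=
  if (j < p - 1)%N then Emx j (v.1 j) else Elast v.2.

Definition ab (v : theta_param) : 'M[R]_d :=
  (\big[mulmx/1%:M]_(1 <= j < p | ~~ odd j) Etheta v j) *m
  (\big[mulmx/1%:M]_(1 <= j < p | odd j) Etheta v j).

Definition positive_element (P : 'M[R]_d) : Prop :=
  exists v : 'I_(p - 1) -> theta_param,
    (forall i, V_Theta (v i)) /\ P = \big[mulmx/1%:M]_(i < p - 1) ab (v i).

(* Partial flags are families of subspaces indexed by the dimension, of which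
   only the dimensions in Theta_dim matter. *)
Definition flag : Type := nat -> grass R d.

Definition Theta_dim (l : nat) : bool :=
  (1 <= l <= p - 1)%N || (q + 1 <= l <= q + p - 1)%N.

Definition Q_orthogonal (V : 'M[R]_d) : grass R d :=
  rowspan (kermx (Qmx *m V^T)).

Definition in_F (A : flag) : Prop :=
  [/\ forall l, (1 <= l <= p - 1)%N -> \rank (A l) = l,
      forall l m, (1 <= l <= m)%N -> (m <= p - 1)%N -> (A l <= A m)%MS,
      forall l, (1 <= l <= p - 1)%N -> A l *m Qmx *m (A l)^T = 0
    & forall l, (1 <= l <= p - 1)%N -> A (d - l)%N = Q_orthogonal (A l)].

Definition eq_flag (A B : flag) : Prop := forall l, Theta_dim l -> A l = B l.

Definition flag_act (g : 'M[R]_d) (A : flag) : flag :=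
  fun l => grass_act g (A l).

(* Z^l = <e_1, ..., e_l> and X^l = <e_d, ..., e_{d-l+1}> *)
Definition Zflag : flag := fun l => rowspan (pid_mx l : 'M[R]_d).
Definition Xflag : flag := fun l => rowspan (copid_mx (d - l) : 'M[R]_d).

Definition Theta_positive_triple (A B C : flag) : Prop :=
  exists g P, [/\ SO0 g, positive_element P,
    eq_flag (flag_act g A) Xflag,
    eq_flag (flag_act g B) (flag_act P Xflag)
  & eq_flag (flag_act g C) Zflag].

Variables (Gamma : groupType) (S : seq Gamma).

Definition SO_representation (rho : Gamma -> 'M[R]_d) : Prop :=
  [/\ rho 1%g = 1%:M, forall x y, rho (x * y)%g = rho x *m rho y
    & forall x, SO (rho x)].

Definition Theta_positive (theta : boundary S -> R * R)
    (rho : Gamma -> 'M[R]_d) : Prop :=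
  let J := iota 1 (p - 1) in
  anosov_on S rho J /\
  exists xi : nat -> boundary S -> grass R d,
    [/\ {in J, forall j, limit_maps rho j xi},
        forall x, in_F (xi ^~ x)
      & forall z y x, positively_oriented theta z y x ->
          Theta_positive_triple (xi ^~ z) (xi ^~ y) (xi ^~ x)].

End ThetaPositive.

(* Main.v *)
Require Import Defs.
From HB Require Import structures.
From mathcomp Require Import all_boot all_order all_algebra.
From mathcomp Require Import all_classical all_reals all_analysis.
From mathcomp Require Import zify ring lra.
Import numFieldNormedType.Exports.

(** Why property C_k holds.  Of three distinct points x, y, z of the boundary
circle, one of the triples (z, y, x), (y, z, x) is positively oriented, so that
up to an element of SO_0(p,q) the point x has flag Z, one of y, z has flag X
and the other one has flag PX, with P a positive element.  Written in the basis
e_1, ..., e_d, directness of x^{d-k-2} + (y^k cap x^{d-k+1}) + z^{k+1} becomes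
the nonvanishing of one minor of P.  As k <= p - 3, all its rows and columns
lie in the lower right block of size p - 1, where P is upper unitriangular, and
the minor reduces to one of the 3 x 3 diagonal block of P starting at the basis
vector number a = d - k - 1:
- if (z, y, x) is positive, y^k cap x^{d-k+1} is spanned by a vector with
  coordinates (P_{a,a+2}, P_{a+1,a+2}, 1) in this block and zeros after it, and
  the minor is P_{a,a+2} ([corner_direct_line]);
- if (y, z, x) is positive, y^k cap x^{d-k+1} is the line of e_{a+2}, and the
  minor is P_{a,a+1} P_{a+1,a+2} - P_{a,a+2} ([corner_direct_point]).

Both are positive, by the simplest case of total positivity.  Passing to the
3 x 3 block is multiplicative on such matrices; E_{k+1}(v) and E_k(v) become
the elementary matrices 1 + v e_{12} and 1 + v e_{23}, and every other E_j
becomes the identity.  The matrices with nonnegative P_{a,a+1}, P_{a+1,a+2},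
P_{a,a+2} and P_{a,a+1} P_{a+1,a+2} - P_{a,a+2} form a monoid; as ab(v) occurs
at least twice in P, the factors E_{k+1} and E_k occur in both orders, which
makes both minors positive ([corner_positive_element]).

The boundary maps for property C_k are those of the positive representation,
except that k = 1 also involves the dimensions 0 and d, where the maps must be
constant ([limit_map_const]). *)

Set Implicit Arguments.
Unset Strict Implicit.
Unset Printing Implicit Defensive.

Import Order.TTheory GRing.Theory Num.Theory.
Local Open Scope classical_set_scope.
Local Open Scope ring_scope.

(** * Triangular tails and their corner minors *)

Section TriangularTail.
Variables (R : realType) (d : nat).
Implicit Types (M N : 'M[R]_d) (u t : 'rV[R]_d).

(** Upper unitriangularity is recorded only from row [l] on, because there
E_{p-1}(v) agrees with the identity matrix. *)
Definition unitri_from (l : nat) M : Prop :=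
  forall i j : 'I_d, (l <= i)%N -> (j <= i)%N -> M i j = (i == j)%:R.

Lemma unitri_from1 l : unitri_from l 1%:M.
Proof. by move=> i j _ _; rewrite mxE. Qed.

Lemma unitri_from_mul l M N :
  unitri_from l M -> unitri_from l N -> unitri_from l (M *m N).
Proof.
move=> hM hN i j li ji; rewrite mxE (bigD1 i) //= (hM i i) // eqxx mul1r hN //.
rewrite big1 ?addr0 // => m mi; case: (ltnP m i) => im.
  by rewrite (hM i m) ?(ltnW im) // eq_sym (negbTE mi) mul0r.
have {}im : (i < m)%N by rewrite ltn_neqAle im andbT eq_sym.
rewrite (hN m j); [|lia|lia].
suff -> : (m == j) = false by rewrite mulr0.
by apply/negbTE; rewrite -val_eqE /=; lia.
Qed.

Lemma unitri_superdiag_mul l M N (i j : 'I_d) :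
  unitri_from l M -> unitri_from l N -> (l <= i)%N -> j = i.+1 :> nat ->
  (M *m N) i j = M i j + N i j.
Proof.
move=> hM hN li ij.
have ji : j != i by rewrite -val_eqE /=; lia.
rewrite mxE (bigD1 i) //= (bigD1 j) //= (hM i i) // eqxx mul1r.
rewrite (hN j j) //; last lia.
rewrite eqxx mulr1 big1 ?addr0 1?addrC // => m /andP[mi mj].
move: mi mj; rewrite -!val_eqE /= => mi mj.
have [im|im] := ltnP m i.
  by rewrite (hM i m) ?(ltnW im) // -val_eqE /= eq_sym (negbTE mi) mul0r.
rewrite (hN m j); [|lia|lia].
by rewrite -val_eqE /= (negbTE mj) mulr0.
Qed.

Lemma unitri_second_mul l M N (i j k : 'I_d) :
  unitri_from l M -> unitri_from l N -> (l <= i)%N ->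
  j = i.+1 :> nat -> k = i.+2 :> nat ->
  (M *m N) i k = M i k + M i j * N j k + N i k.
Proof.
move=> hM hN li ij ik.
have ji : j != i by rewrite -val_eqE /=; lia.
have ki : k != i by rewrite -val_eqE /=; lia.
have kj : k != j by rewrite -val_eqE /=; lia.
rewrite mxE (bigD1 i) //= (bigD1 j) //= (bigD1 k) /=; last by rewrite ki kj.
rewrite (hM i i) // eqxx mul1r (hN k k) //; last lia.
rewrite eqxx mulr1 big1 ?addr0; last first.
  move=> m /andP[/andP[]]; rewrite -!val_eqE /= => mi mj mk.
  have [im|im] := ltnP m i.
    by rewrite (hM i m) ?(ltnW im) // -val_eqE /= eq_sym (negbTE mi) mul0r.
  rewrite (hN m k); [|lia|lia].
  by rewrite -val_eqE /= (negbTE mk) mulr0.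
by rewrite addrC [M i j * _ + _]addrC.
Qed.

(** Back substitution: a combination of the columns of [M] that vanishes in the
rows from [m] on has no contribution from the columns from [m] on. *)
Lemma unitri_solve l m M t : unitri_from l M -> (l <= m)%N ->
  (forall i : 'I_d, (m <= i)%N -> (t *m M^T) 0 i = 0) ->
  forall i : 'I_d, (m <= i)%N -> t 0 i = 0.
Proof.
move=> hM lm h i; have [n] := ubnP (d - i); elim: n i => // n IH i din mi.
have := h i mi; rewrite mxE (bigD1 i) //= mxE hM ?(leq_trans lm) //.
rewrite eqxx mulr1 big1 ?addr0 // => j ji; rewrite mxE.
have {}ji : j != i :> nat by rewrite val_eqE.
case: (ltnP j i) => ij.
  rewrite (hM i j) ?(ltnW ij) ?(leq_trans lm) //.
  by rewrite -val_eqE /= eq_sym (negbTE ji) mulr0.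
by rewrite IH ?mul0r //; have := ltn_ord j; have := ltn_ord i; lia.
Qed.

Section Corner.
Variables (i0 i1 i2 : 'I_d).
Hypotheses (i01 : i1 = i0.+1 :> nat) (i02 : i2 = i0.+2 :> nat).

(** Total nonnegativity of the 3 x 3 block on the consecutive indices
[i0], [i1], [i2]. *)
Definition corner_nonneg M : Prop :=
  [/\ unitri_from i0 M, 0 <= M i0 i1, 0 <= M i1 i2
    & 0 <= M i0 i2 <= M i0 i1 * M i1 i2].

(** The strict form needed for transversality: [M i0 i2] is the minor with rows
[i0] and columns [i2], and [M i0 i1 * M i1 i2 - M i0 i2] the one with rows
[i0], [i1] and columns [i1], [i2]. *)
Definition corner_pos M : Prop :=
  unitri_from i0 M /\ 0 < M i0 i2 < M i0 i1 * M i1 i2.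

Lemma corner_mulE M N : unitri_from i0 M -> unitri_from i0 N ->
  [/\ (M *m N) i0 i1 = M i0 i1 + N i0 i1,
      (M *m N) i1 i2 = M i1 i2 + N i1 i2
    & (M *m N) i0 i2 = M i0 i2 + M i0 i1 * N i1 i2 + N i0 i2].
Proof.
move=> hM hN; split.
- exact: unitri_superdiag_mul hM hN _ _.
- by apply: unitri_superdiag_mul hM hN _ _; rewrite ?i01 // i02.
- exact: unitri_second_mul hM hN _ _ _.
Qed.

Lemma corner_nonneg1 : corner_nonneg 1%:M.
Proof.
split; first exact: unitri_from1.
all: rewrite !mxE -!val_eqE /= ?i02 ?i01.
all: by rewrite ?[i0 == _ :> nat]ltn_eqF ?ltn_eqF //= ?mul0r ?lexx.
Qed.

Lemma corner_nonneg_mul M N :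
  corner_nonneg M -> corner_nonneg N -> corner_nonneg (M *m N).
Proof.
move=> [uM M1 M2 /andP[M3 M4]] [uN N1 N2 /andP[N3 N4]].
have [e1 e2 e3] := corner_mulE uM uN.
split; rewrite ?e1 ?e2 ?e3; [exact: unitri_from_mul|lra|lra|].
have MN : 0 <= M i0 i1 * N i1 i2 by apply: mulr_ge0.
have NM : 0 <= N i0 i1 * M i1 i2 by apply: mulr_ge0.
by apply/andP; split; nra.
Qed.

(** The minors of the product contain the cross terms [M i0 i1 * N i1 i2] and
[N i0 i1 * M i1 i2], one for each order of the two elementary factors; this is
where strict positivity comes from. *)
Lemma corner_pos_mul M N : corner_nonneg M -> corner_nonneg N ->
  0 < M i0 i1 -> 0 < M i1 i2 -> 0 < N i0 i1 -> 0 < N i1 i2 ->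
  corner_pos (M *m N).
Proof.
move=> [uM M1 M2 /andP[M3 M4]] [uN N1 N2 /andP[N3 N4]] m1 m2 n1 n2.
have [e1 e2 e3] := corner_mulE uM uN.
split; rewrite ?e1 ?e2 ?e3; first exact: unitri_from_mul.
have MN : 0 < M i0 i1 * N i1 i2 by apply: mulr_gt0.
have NM : 0 < N i0 i1 * M i1 i2 by apply: mulr_gt0.
by apply/andP; split; nra.
Qed.

Lemma corner_nonneg_big (I : Type) (r : seq I) (Q : pred I) (F : I -> 'M[R]_d) :
  (forall i, Q i -> corner_nonneg (F i)) ->
  corner_nonneg (\big[mulmx/1%:M]_(i <- r | Q i) F i).
Proof.
move=> hF; elim/big_ind: _ => //; first exact: corner_nonneg1.
exact: corner_nonneg_mul.
Qed.

(** Superdiagonal entries add up in a product, so each factor contributes a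
lower bound. *)
Lemma corner_le_big (I : eqType) (r : seq I) (Q : pred I) (F : I -> 'M[R]_d) j :
  (forall i, Q i -> corner_nonneg (F i)) -> j \in r -> Q j ->
  let M := \big[mulmx/1%:M]_(i <- r | Q i) F i in
  F j i0 i1 <= M i0 i1 /\ F j i1 i2 <= M i1 i2.
Proof.
move=> hF + Qj /=; elim: r => // a r IH; rewrite inE big_cons.
have hr := corner_nonneg_big r hF.
case/orP => [/eqP <-|jr].
  rewrite Qj; have [uj j1 j2 _] := hF _ Qj; case: hr => ur r1 r2 _.
  have [-> -> _] := corner_mulE uj ur; lra.
have [h1 h2] := IH jr; case: ifP => // Qa.
have [ua a1 a2 _] := hF _ Qa; case: hr => ur r1 r2 _.
have [-> -> _] := corner_mulE ua ur; lra.
Qed.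

Lemma corner_pos_big (I : eqType) (r : seq I) (F : I -> 'M[R]_d) :
  (1 < size r)%N ->
  (forall i, [/\ corner_nonneg (F i), 0 < F i i0 i1 & 0 < F i i1 i2]) ->
  corner_pos (\big[mulmx/1%:M]_(i <- r) F i).
Proof.
case: r => [|a [|b r]] //= _ hF; rewrite big_cons.
have [Fa a1 a2] := hF a; have [_ b1 b2] := hF b.
have hF' i : xpredT i -> corner_nonneg (F i) by case: (hF i).
have [h1 h2] := corner_le_big (r := b :: r) hF' (mem_head b r) isT.
apply: corner_pos_mul => //; first exact: corner_nonneg_big.
- exact: lt_le_trans h1.
- exact: lt_le_trans h2.
Qed.

End Corner.
End TriangularTail.

(** * The corner of a positive element *)

Section ThetaCorner.
Variables (R : realType) (p q k : nat).
Hypotheses (pq : (p < q)%N) (hk : (1 <= k <= p - 3)%N).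
Local Notation d := (p + q)%N.
Variables (i0 i1 i2 : 'I_d).
Hypotheses (i0E : i0 = (d - k - 2)%N :> nat).
Hypotheses (i01 : i1 = i0.+1 :> nat) (i02 : i2 = i0.+2 :> nat).
Implicit Types (v : theta_param R p q).

(** In the rows of the lower right block only the lower one of the two entries
[x] of E_j(x) is visible. *)
Lemma Emx_entry j (x : R) (a b : 'I_d) : (1 <= j < p - 1)%N -> (q < a)%N ->
  Emx p q j x a b =
    if (a == d - j.+1 :> nat)%N && (b == d - j :> nat)%N then x
    else (a == b)%:R.
Proof.
move=> hj qa; rewrite mxE; congr (if _ then _ else _).
have -> : (a.+1 == j) = false by apply/negbTE/eqP; lia.
by congr (_ && _); apply/eqP/eqP; lia.
Qed.

Lemma Elast_entry (x : 'cV[R]_((q - p).+2)) (a b : 'I_d) : (q < a)%N ->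
  Elast x a b = (a == b)%:R.
Proof.
move=> qa; rewrite mxE.
have -> : (a == p - 2 :> nat)%N = false by apply/negbTE/eqP; lia.
by rewrite [(a <= q)%N]leqNgt qa andbF.
Qed.

Lemma corner_nonneg_Etheta v j : V_Theta v -> (1 <= j < p)%N ->
  corner_nonneg i0 i1 i2 (Etheta v j).
Proof.
case=> v0 _ hj; rewrite /Etheta.
have qi0 : (q < i0)%N by lia.
have i2d := ltn_ord i2.
case: ltnP => jp; last first.
  have [_ n1 n2 n3] := corner_nonneg1 R i01 i02.
  have eL (a b : 'I_d) : (i0 <= a)%N -> Elast v.2 a b = 1%:M a b.
    by move=> ha; rewrite Elast_entry; [rewrite mxE | lia].
  split; rewrite ?eL ?i01 //.
  by move=> a b ha hb; rewrite eL // mxE.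
have vj : 0 < v.1 j by apply: v0; lia.
have hj' : (1 <= j < p - 1)%N by lia.
split.
- move=> a b ha hb; rewrite Emx_entry //; last lia.
  by case: ifP => // /andP[/eqP h1 /eqP h2]; lia.
- by rewrite Emx_entry //; case: ifP => _; rewrite ?ler0n // ltW.
- by rewrite Emx_entry //; [case: ifP => _; rewrite ?ler0n // ltW|lia].
- rewrite !Emx_entry //; try lia.
  rewrite -!val_eqE /=.
  (* E_j has no entry on the second superdiagonal *)
  rewrite [X in if X then _ else _](_ : _ = false); last first.
    by apply/negbTE/negP=> /andP[/eqP ? /eqP ?]; lia.
  rewrite (_ : (_ == _ :> nat) = false) ?lexx /=; last first.
    by apply/negbTE/eqP; lia.
  by rewrite mulr_ge0 //; case: ifP => _; rewrite ?ler0n // ltW.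
Qed.

(** Whether k is even or odd, E_{k+1} and E_k occur once each in ab(v), one in
the even and one in the odd half. *)
Lemma corner_ab v : V_Theta v ->
  [/\ corner_nonneg i0 i1 i2 (ab v), 0 < ab v i0 i1 & 0 < ab v i1 i2].
Proof.
move=> hv.
have qi0 : (q < i0)%N by lia.
have i2d := ltn_ord i2.
pose F Q := \big[mulmx/1%:M]_(j <- index_iota 1 p | (1 <= j < p)%N && Q j)
  Etheta v j.
have hE (Q : pred nat) j : (1 <= j < p)%N && Q j ->
    corner_nonneg i0 i1 i2 (Etheta v j).
  by case/andP => hj _; exact: corner_nonneg_Etheta.
(* the range is recorded in the filter, as positivity of [v.1 j] needs it *)
have abE : ab v = F (fun j => ~~ odd j) *m F odd.
  by rewrite /ab /F; congr (_ *m _); rewrite big_nat_cond.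
have nn Q : corner_nonneg i0 i1 i2 (F Q).
  by apply: (corner_nonneg_big i01 i02) => j; exact: hE.
have [u0 u1] := (nn (fun j => ~~ odd j), nn odd).
have mem j : (1 <= j < p)%N -> j \in index_iota 1 p by rewrite mem_index_iota.
have [k1 k2] : (1 <= k.+1 < p)%N /\ (1 <= k < p)%N by lia.
have [v1 v2] : 0 < Etheta v k.+1 i0 i1 /\ 0 < Etheta v k i1 i2.
  case: hv => v0 _; rewrite /Etheta !ifT; [|lia|lia].
  rewrite !Emx_entry; [|lia|lia|lia|lia].
  rewrite !ifT; [|apply/andP; split; apply/eqP; lia..].
  by split; apply: v0; lia.
have le1 (Q : pred nat) : Q k.+1 -> 0 < F Q i0 i1.
  move=> Qk; apply: lt_le_trans v1 _.
  have hQ : (1 <= k.+1 < p)%N && Q k.+1 by rewrite k1.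
  by case: (corner_le_big i01 i02 (@hE Q) (mem _ k1) hQ).
have le2 (Q : pred nat) : Q k -> 0 < F Q i1 i2.
  move=> Qk; apply: lt_le_trans v2 _.
  have hQ : (1 <= k < p)%N && Q k by rewrite k2.
  by case: (corner_le_big i01 i02 (@hE Q) (mem _ k2) hQ).
have [U1 p1 p2 _] := u0; have [U2 p3 p4 _] := u1.
have [e1 e2 _] := corner_mulE i01 i02 U1 U2.
rewrite abE; split; rewrite ?e1 ?e2; first exact: corner_nonneg_mul.
- have [ok|ek] := boolP (odd k).
    by rewrite ltr_pwDl ?le1 //= negbK.
  by rewrite ltr_wpDl ?le1 //= ek.
- have [ok|ek] := boolP (odd k); first by rewrite ltr_wpDl ?le2.
  by rewrite ltr_pwDl ?le2.
Qed.

Lemma corner_positive_element (P : 'M[R]_d) :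
  positive_element P -> corner_pos i0 i1 i2 P.
Proof.
case=> v [hv ->]; apply: (corner_pos_big i01 i02).
  by rewrite /index_enum -enumT size_enum_ord; lia.
by move=> i; apply: corner_ab.
Qed.

End ThetaCorner.

(** * Direct sums read off from the corner *)

Lemma mxdirect3 (F : fieldType) (n : nat) (A B C : 'M[F]_n) :
  (forall a b c : 'rV[F]_n, (a <= A)%MS -> (b <= B)%MS -> (c <= C)%MS ->
     a + b + c = 0 -> b = 0 /\ c = 0) ->
  mxdirect (A + B + C)%MS.
Proof.
move=> h.
have cap0 (V W : 'M[F]_n) :
    (forall v : 'rV[F]_n, (v <= V)%MS -> (v <= W)%MS -> v = 0) ->
    (V :&: W = 0)%MS.
  move=> h0; apply/eqP; rewrite -submx0; apply/rV_subP => v.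
  by rewrite sub_capmx => /andP[/h0 h1 /h1 ->]; rewrite sub0mx.
rewrite mxdirectE /= !mxrank_disjoint_sum //; apply: cap0 => v.
- move=> vA vB; have [] := h (- v) v 0; rewrite ?eqmx_opp ?sub0mx //.
  by rewrite addr0 addNr.
- case/sub_addsmxP => -[s t] /= -> vC.
  have [] := h (s *m A) (t *m B) (- (s *m A + t *m B)).
  + exact: submxMl.
  + exact: submxMl.
  + by rewrite eqmx_opp.
  + by rewrite addrN.
  + by move=> _ /eqP; rewrite oppr_eq0 => /eqP.
Qed.

Section CornerDirect.
Variables (R : realType) (d : nat) (i0 i1 i2 : 'I_d) (P : 'M[R]_d).
Hypotheses (i01 : i1 = i0.+1 :> nat) (i02 : i2 = i0.+2 :> nat).
Hypothesis hP : corner_pos i0 i1 i2 P.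
Implicit Types (a b c t : 'rV[R]_d).

(** The summands of the case (z, y, x): [a] in Z^{d-k-2}, [b] in the
intersection of PX^k and Z^{d-k+1}, [c] in X^{k+1}.  Back
substitution leaves [t], hence [b], with one free coordinate [t 0 i2]; at [i0]
the sum reads [t 0 i2 * P i0 i2 = 0]. *)
Lemma corner_direct_line a b c t :
  (forall i : 'I_d, (i0 <= i)%N -> a 0 i = 0) ->
  (forall i : 'I_d, (i2 < i)%N -> b 0 i = 0) ->
  (forall i : 'I_d, (i < i1)%N -> c 0 i = 0) ->
  (forall i : 'I_d, (i < i2)%N -> t 0 i = 0) ->
  b = t *m P^T -> a + b + c = 0 -> b = 0 /\ c = 0.
Proof.
move=> ha hb hc ht bE s0; have [uP /andP[P02 _]] := hP.
have ht' (i : 'I_d) : (i2 < i)%N -> t 0 i = 0.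
  move=> i2i; apply: (unitri_solve uP (m := i2.+1)) => //; first by lia.
  by rewrite -bE.
have sE i : a 0 i + b 0 i + c 0 i = 0.
  by move/(congr1 (fun u : 'rV_d => u 0 i)): s0; rewrite !mxE.
have t2 : t 0 i2 = 0.
  have := sE i0; rewrite ha // hc ?i01 // add0r addr0 bE mxE (bigD1 i2) //=.
  rewrite big1 => [|j ji2]; last first.
    have [/ht ->|ij] := ltnP j i2; first by rewrite mul0r.
    by rewrite ht' ?mul0r // ltn_neqAle ij andbT eq_sym.
  rewrite addr0 mxE => /eqP; rewrite mulf_eq0 => /orP[/eqP //|].
  by rewrite gt_eqF.
have b0 : b = 0.
  rewrite bE (_ : t = 0) ?mul0mx //; apply/rowP => j; rewrite mxE.
  by have [/ht //|/ht' //|/val_inj ->] := ltngtP j i2.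
split=> //; apply/rowP => j; rewrite mxE.
have [/hc //|ij] := ltnP j i1.
by have := sE j; rewrite b0 mxE ha ?add0r //; lia.
Qed.

(** The summands of the case (y, z, x): [a] in Z^{d-k-2}, [b] in the
intersection of X^k and Z^{d-k+1}, [c] in PX^{k+1}.  Back
substitution leaves [t] with the two coordinates at [i1] and [i2], and the sum
at [i0] and [i1] is a 2 x 2 linear system for them whose determinant is the
second corner minor. *)
Lemma corner_direct_point a b c t :
  (forall i : 'I_d, (i0 <= i)%N -> a 0 i = 0) ->
  (forall i : 'I_d, (i2 < i)%N -> b 0 i = 0) ->
  (forall i : 'I_d, (i < i2)%N -> b 0 i = 0) ->
  (forall i : 'I_d, (i < i1)%N -> t 0 i = 0) ->
  c = t *m P^T -> a + b + c = 0 -> b = 0 /\ c = 0.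
Proof.
move=> ha hb hb' ht cE s0; have [uP /andP[P02 P012]] := hP.
have sE i : a 0 i + b 0 i + c 0 i = 0.
  by move/(congr1 (fun u : 'rV_d => u 0 i)): s0; rewrite !mxE.
have ht' (i : 'I_d) : (i2 < i)%N -> t 0 i = 0.
  move=> i2i; apply: (unitri_solve uP (m := i2.+1)) => //; first by lia.
  move=> j i2j; rewrite -cE; have := sE j.
  by rewrite ha ?hb // ?add0r //; lia.
have i21 : i2 != i1 by rewrite -val_eqE /=; lia.
have c_entry i : c 0 i = t 0 i1 * P i i1 + t 0 i2 * P i i2.
  rewrite cE mxE (bigD1 i1) //= (bigD1 i2) //= big1 ?addr0 ?mxE // => j.
  rewrite -!val_eqE /= => /andP[j1 j2].
  have [/ht ->|ij] := ltnP j i1; first by rewrite mul0r.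
  by rewrite ht' ?mul0r //; lia.
have eq0 : t 0 i1 * P i0 i1 + t 0 i2 * P i0 i2 = 0.
  by rewrite -c_entry -[RHS](sE i0) ha // hb' ?add0r // i02.
have eq1 : t 0 i1 + t 0 i2 * P i1 i2 = 0.
  rewrite -{1}[t 0 i1]mulr1 -[1](_ : P i1 i1 = 1) -?c_entry.
    by rewrite -[RHS](sE i1) ha ?hb' ?add0r // ?i01 ?i02 // leqnSn.
  by rewrite uP ?eqxx // i01.
have t2 : t 0 i2 = 0.
  (* Cramer's rule *)
  have /eqP : t 0 i2 * (P i0 i1 * P i1 i2 - P i0 i2) = 0.
    rewrite (_ : _ * _ = (t 0 i1 + t 0 i2 * P i1 i2) * P i0 i1
      - (t 0 i1 * P i0 i1 + t 0 i2 * P i0 i2)); last by ring.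
    by rewrite eq0 eq1 mul0r subr0.
  by rewrite mulf_eq0 subr_eq0 (gt_eqF P012) orbF => /eqP.
have t1 : t 0 i1 = 0 by move: eq1; rewrite t2 mul0r addr0.
have c0 : c = 0 by apply/rowP => i; rewrite c_entry t1 t2 !mul0r addr0 mxE.
split=> //; apply/rowP => j; rewrite mxE.
have [/hb' //|ij] := ltnP j i2.
by have := sE j; rewrite c0 mxE ha ?add0r ?addr0 //; lia.
Qed.

End CornerDirect.

(** * Flags and positive triples *)

Section Flags.
Variables (R : realType) (p q : nat).
Local Notation d := (p + q)%N.
Implicit Types (u t : 'rV[R]_d).

Lemma sub_Zflag l u : (u <= Zflag R p q l)%MS ->
  forall i : 'I_d, (l <= i)%N -> u 0 i = 0.
Proof.
rewrite genmxE => /submxP[w ->] i li; rewrite mxE big1 // => j _; rewrite mxE.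
case: eqP => [/= ->|_]; last by rewrite mulr0.
by rewrite ltnNge li mulr0.
Qed.

Lemma sub_Xflag l u : (u <= Xflag R p q l)%MS ->
  forall i : 'I_d, (i < d - l)%N -> u 0 i = 0.
Proof.
rewrite genmxE => /submxP[w ->] i li.
rewrite /copid_mx mulmxBr mulmx1 !mxE (bigD1 i) //= mxE eqxx li mulr1.
rewrite big1 ?addr0 ?subrr // => j ji; rewrite mxE.
by rewrite val_eqE (negbTE ji) mulr0.
Qed.

Lemma sub_grass_act (M : 'M[R]_d) (V : grass R d) u :
  (u <= V)%MS -> (u *m M^T <= grass_act M V)%MS.
Proof. by move=> uV; rewrite genmxE submxMr. Qed.

Lemma grass_act_sub (M : 'M[R]_d) (V : grass R d) u :
  (u <= grass_act M V)%MS -> exists2 t, (t <= V)%MS & u = t *m M^T.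
Proof.
rewrite genmxE => /submxP[w ->]; exists (w *m V); first exact: submxMl.
by rewrite mulmxA.
Qed.

Lemma SO0_unit (M : 'M[R]_d) : SO0 M -> M \in unitmx.
Proof.
by move=> /connected_component_sub[_ detM]; rewrite unitmxE detM unitr1.
Qed.

Variable k : nat.
Hypotheses (pq : (p < q)%N) (hk : (1 <= k <= p - 3)%N).

Lemma flag_corner_indices : exists i0 i1 i2 : 'I_d,
  [/\ i0 = (d - k - 2)%N :> nat, i1 = i0.+1 :> nat & i2 = i0.+2 :> nat].
Proof.
have h0 : (d - k - 2 < d)%N by lia.
have h1 : (d - k - 1 < d)%N by lia.
have h2 : (d - k < d)%N by lia.
by exists (Ordinal h0), (Ordinal h1), (Ordinal h2); split => //=; lia.
Qed.

(** [W] stands for x^{d-k+1}.  Membership in it only enters through the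
vanishing of the coordinates beyond [i2], and there are none when k = 1, the
case where the flags have no member of dimension d - k + 1 = d. *)
Lemma positive_triple_direct (x y z : flag R p q) (W : grass R d) :
  ((1 < k)%N -> W = x (d - k + 1)%N) ->
  Theta_positive_triple z y x \/ Theta_positive_triple y z x ->
  mxdirect (x (d - k - 2)%N + (y k :&: W) + z k.+1)%MS.
Proof.
move=> hW hpos; have [i0 [i1 [i2 [i0E i01 i02]]]] := flag_corner_indices.
have [dx dk dk1] : [/\ Theta_dim p q (d - k - 2)%N, Theta_dim p q k
    & Theta_dim p q k.+1] by rewrite /Theta_dim; split; lia.
have Z0 u : (u <= Zflag R p q (d - k - 2)%N)%MS ->
    forall i : 'I_d, (i0 <= i)%N -> u 0 i = 0.
  by move=> /sub_Zflag h i; rewrite i0E; exact: h.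
have Xk u : (u <= Xflag R p q k)%MS ->
    forall i : 'I_d, (i < i2)%N -> u 0 i = 0.
  by move=> /sub_Xflag h i ii; apply: h; lia.
have Xk1 u : (u <= Xflag R p q k.+1)%MS ->
    forall i : 'I_d, (i < i1)%N -> u 0 i = 0.
  by move=> /sub_Xflag h i ii; apply: h; lia.
have ZW (h : 'M[R]_d) u : eq_flag (flag_act h x) (Zflag R p q) ->
    (u <= W)%MS -> forall i : 'I_d, (i2 < i)%N -> (u *m h^T) 0 i = 0.
  move=> hx uW i i2i; have id := ltn_ord i; have k1 : (1 < k)%N by lia.
  have D : Theta_dim p q (d - k + 1)%N by rewrite /Theta_dim; lia.
  apply: (sub_Zflag (l := (d - k + 1)%N)); last by lia.
  by rewrite -hx // /flag_act -hW //; exact: sub_grass_act.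
have back (h : 'M[R]_d) u : SO0 h -> u *m h^T = 0 -> u = 0.
  move=> /SO0_unit; rewrite -unitmx_tr => uh hu0.
  by rewrite -(mulmxK uh u) hu0 mul0mx.
have sum0 (h : 'M[R]_d) (a b c : 'rV[R]_d) :
    a + b + c = 0 -> a *m h^T + b *m h^T + c *m h^T = 0.
  by move=> s0; rewrite -!mulmxDl s0 mul0mx.
apply: mxdirect3 => a b c aA; rewrite sub_capmx => /andP[bY bW] cC s0.
case: hpos => -[h [P [SOh Ppos hA hB hC]]].
- have hP := corner_positive_element pq hk i0E i01 i02 Ppos.
  have [t tX bE] : exists2 t, (t <= Xflag R p q k)%MS & b *m h^T = t *m P^T.
    apply: grass_act_sub; move: (hB _ dk); rewrite /flag_act => <-.
    exact: sub_grass_act.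
  have [] := corner_direct_line (P := P) i01 i02 hP (a := a *m h^T)
    (b := b *m h^T) (c := c *m h^T) (t := t) => //.
  + by apply: Z0; rewrite -hC //; exact: sub_grass_act.
  + exact: ZW.
  + by apply: Xk1; rewrite -hA //; exact: sub_grass_act.
  + exact: Xk.
  + exact: sum0.
  + by move=> /(back _ _ SOh) -> /(back _ _ SOh) ->.
- have hP := corner_positive_element pq hk i0E i01 i02 Ppos.
  have [t tX cE] : exists2 t, (t <= Xflag R p q k.+1)%MS & c *m h^T = t *m P^T.
    apply: grass_act_sub; move: (hB _ dk1); rewrite /flag_act => <-.
    exact: sub_grass_act.
  have [] := corner_direct_point (P := P) i01 i02 hP (a := a *m h^T)
    (b := b *m h^T) (c := c *m h^T) (t := t) => //.
  + by apply: Z0; rewrite -hC //; exact: sub_grass_act.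
  + exact: ZW.
  + by apply: Xk; rewrite -hA //; exact: sub_grass_act.
  + exact: Xk1.
  + exact: sum0.
  + by move=> /(back _ _ SOh) -> /(back _ _ SOh) ->.
Qed.

End Flags.

(** * Orientation of triples on the circle *)

(** The two determinants are opposite, so it suffices that three distinct points
of the circle are not collinear.  With u = theta z, put a = theta y - u and
b = theta x - u, with Gram entries A = a.a, B = b.b, C = a.b.  Lying on the
circle means A = - 2 (u.a) and B = - 2 (u.b); if a and b are parallel, then
(u.b) A = (u.a) C and (u.a) B = (u.b) C, so A = C = B and
|a - b|^2 = A + B - 2 C = 0. *)
Lemma oriented_or_swap (R : realType) (T : topologicalType)
    (theta : T -> R * R) (x y z : T) :
  circle_homeo theta -> x <> y -> y <> z -> x <> z ->
  positively_oriented theta z y x \/ positively_oriented theta y z x.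
Proof.
case=> _ inj rg _ xy yz xz; rewrite /positively_oriented.
have on t : (theta t).1 ^+ 2 + (theta t).2 ^+ 2 = 1.
  have : range theta (theta t) by exists t.
  by rewrite rg.
have sq0 (a b : R) : a ^+ 2 + b ^+ 2 = 0 -> a = 0 /\ b = 0.
  move=> /eqP; rewrite paddr_eq0 ?sqr_ge0 // !sqrf_eq0.
  by case/andP => /eqP -> /eqP ->.
have neq s t : s <> t ->
    ((theta s).1 - (theta t).1) ^+ 2 + ((theta s).2 - (theta t).2) ^+ 2 != 0.
  move=> st; apply/eqP => /sq0[/eqP + /eqP].
  rewrite !subr_eq0 => /eqP e1 /eqP e2; apply: st; apply: inj.
  by rewrite [LHS]surjective_pairing e1 e2 -surjective_pairing.
move: (on x) (on y) (on z) (neq _ _ yz) (neq _ _ xz) (neq _ _ xy).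
move: (theta x) (theta y) (theta z) => [x1 x2] [y1 y2] [z1 z2] /=.
move=> hx hy hz nyz nxz nxy.
set D := (X in 0 < X \/ _).
have -> : (z1 - y1) * (x2 - y2) - (z2 - y2) * (x1 - y1) = - D.
  by rewrite /D; ring.
rewrite oppr_gt0; case: (ltrgtP 0 D) => [|D0|D0]; [by left|by right|].
exfalso.
pose A := (y1 - z1) ^+ 2 + (y2 - z2) ^+ 2.
pose B := (x1 - z1) ^+ 2 + (x2 - z2) ^+ 2.
pose C := (y1 - z1) * (x1 - z1) + (y2 - z2) * (x2 - z2).
pose s := z1 * (y1 - z1) + z2 * (y2 - z2).
pose r := z1 * (x1 - z1) + z2 * (x2 - z2).
have sA : A = - (2 * s).
  have -> : A = (y1 ^+ 2 + y2 ^+ 2) - (z1 ^+ 2 + z2 ^+ 2) - 2 * s.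
    by rewrite /A /s; ring.
  by rewrite hy hz subrr sub0r.
have rB : B = - (2 * r).
  have -> : B = (x1 ^+ 2 + x2 ^+ 2) - (z1 ^+ 2 + z2 ^+ 2) - 2 * r.
    by rewrite /B /r; ring.
  by rewrite hx hz subrr sub0r.
have e1 : r * A - s * C = 0.
  have -> : r * A - s * C = D * (z2 * (y1 - z1) - z1 * (y2 - z2)).
    by rewrite /r /A /s /C /D; ring.
  by rewrite -D0 mul0r.
have e2 : s * B - r * C = 0.
  have -> : s * B - r * C = D * (z1 * (x2 - z2) - z2 * (x1 - z1)).
    by rewrite /r /B /s /C /D; ring.
  by rewrite -D0 mul0r.
have BC : B = C.
  apply: (mulIf (x := A)) => //; apply/eqP; rewrite -subr_eq0; apply/eqP.
  transitivity (- 2 * (r * A - s * C)); last by rewrite e1 mulr0.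
  by rewrite {1}rB [C * A]mulrC {2}sA; ring.
have AC : A = C.
  apply: (mulIf (x := B)) => //; apply/eqP; rewrite -subr_eq0; apply/eqP.
  transitivity (- 2 * (s * B - r * C)); last by rewrite e2 mulr0.
  by rewrite {1}sA [C * B]mulrC {2}rB; ring.
move/eqP: nxy; apply.
transitivity (A + B - 2 * C); first by rewrite /A /B /C; ring.
by rewrite AC BC; ring.
Qed.

(** * Boundary maps in dimensions 0 and d *)

Section TrivialLimitMaps.
Variables (R : realType) (d : nat) (Gamma : groupType) (S : seq Gamma).
Variable rho : Gamma -> 'M[R]_d.
Hypothesis rho_unit : forall x, rho x \in unitmx.

(** The Grassmannian topology is a disjoint union over the dimensions. *)
Lemma open_grass_rank r : open [set W : grass R d | \rank W = r].
Proof.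
move=> j A fA /= rA; apply: filterE => B fB /=.
by rewrite -rA !mxrank_gen (eqP fA) (eqP fB).
Qed.

(** A subspace which is alone in its dimension is fixed by the group and, being
an isolated point, attracts its neighbourhood trivially. *)
Lemma limit_map_const (V : grass R d) :
  (forall W : grass R d, \rank W = \rank V -> W = V) ->
  limit_map rho (\rank V) (fun _ : boundary S => V).
Proof.
move=> Vuniq.
have fixV x : grass_act (rho x) V = V.
  by apply: Vuniq; rewrite mxrank_gen mxrankMfree // row_free_unit unitmx_tr.
split=> //; first exact: cst_continuous.
move=> x b _; split=> //; exists [set W : grass R d | \rank W = \rank V].
  by apply: open_nbhs_nbhs; split => //; exact: open_grass_rank.
move=> N /nbhs_singleton NV; exists 0%N => n _ W /Vuniq ->.
suff -> : iter n (grass_act (rho x)) V = V by [].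
by elim: n => //= n ->.
Qed.

Lemma grass_eqmx (V W : grass R d) : (V == W)%MS -> V = W.
Proof.
move=> /genmxP e; apply: val_inj; case: V W e => [V /= /eqP hV] [W /= /eqP hW].
by rewrite hV hW.
Qed.

Definition extend_limits (xi : nat -> boundary S -> grass R d) j :=
  if j == 0%N then fun=> rowspan (0 : 'M[R]_d)
  else if j == d then fun=> rowspan (1%:M : 'M[R]_d) else xi j.

Lemma extend_limits_id xi j : (0 < j < d)%N -> extend_limits xi j = xi j.
Proof. by case/andP => j0 jd; rewrite /extend_limits gtn_eqF // ltn_eqF. Qed.

Lemma limit_maps0 xi : (0 < d)%N -> limit_maps rho 0 (extend_limits xi).
Proof.
move=> d0; rewrite /limit_maps subn0 /extend_limits eqxx gtn_eqF // eqxx.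
have r0 : \rank (rowspan (0 : 'M[R]_d)) = 0%N by rewrite mxrank_gen mxrank0.
have r1 : \rank (rowspan (1%:M : 'M[R]_d)) = d by rewrite mxrank_gen mxrank1.
split.
- rewrite -[X in limit_map _ X]r0; apply: limit_map_const => W.
  rewrite r0 => /eqP; rewrite mxrank_eq0 => /eqP W0.
  by apply: grass_eqmx; rewrite W0 sub0mx genmxE sub0mx.
- rewrite -[X in limit_map _ X]r1; apply: limit_map_const => W.
  rewrite r1 => Wd; apply: grass_eqmx; rewrite !genmxE submx1 /=.
  by rewrite sub1mx /row_full Wd eqxx.
- move=> x y _; rewrite mxdirectE /= genmx0; split.
    by rewrite adds0mx mxrank0 add0n.
  exact: eqmx_trans (adds0mx _ _) (genmxE _).
Qed.

Lemma limit_maps_extend xi j : (0 < j < d)%N ->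
  limit_maps rho j xi -> limit_maps rho j (extend_limits xi).
Proof.
move=> jd; rewrite /limit_maps !extend_limits_id //.
by case/andP: jd => j0 jd; rewrite subn_gt0 jd ltn_subrL j0 (ltn_trans j0).
Qed.

End TrivialLimitMaps.

Theorem proposition1p9 (R : realType) (g : nat) (Gamma : groupType)
    (S : seq Gamma) (theta : boundary S -> R * R) (p q k : nat)
    (rho : Gamma -> 'M[R]_(p + q)) :
  (2 <= g)%N -> is_surface_group g Gamma ->
  generates S -> circle_homeo theta ->
  (3 <= p)%N -> (p < q)%N ->
  SO_representation rho ->
  Theta_positive theta rho ->
  (1 <= k <= p - 3)%N ->
  property_C S rho k.
Proof.
move=> _ _ _ circ p3 pq [_ _ rhoSO] [ano [xi [lim _ pos]]] hk.
have rho_unit x : rho x \in unitmx.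
  by have [_ det1] := rhoSO x; rewrite unitmxE det1 unitr1.
have inJ j : j \in [:: k.-1; k; k.+1; k.+2] ->
    j = 0%N \/ (0 < j < p + q)%N /\ j \in iota 1 (p - 1).
  rewrite !inE mem_iota; case: j => [|j]; first by left.
  by move=> hj; right; lia.
split.
  by move=> j /inJ[-> //|[_ /ano]].
exists (extend_limits xi); split.
  move=> j /inJ[->|[jd /lim]]; first by apply: limit_maps0 => //; lia.
  exact: limit_maps_extend.
move=> x y z xy yz xz.
rewrite (extend_limits_id _ (j := (p + q - k - 2)%N)); last lia.
rewrite (extend_limits_id _ (j := k)); last lia.
rewrite (extend_limits_id _ (j := k.+1)); last lia.
apply: (positive_triple_direct (x := xi ^~ x) (y := xi ^~ y) (z := xi ^~ z)
  pq hk).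
- by move=> k1; rewrite extend_limits_id //; lia.
- have [h|h] := oriented_or_swap circ xy yz xz; [left|right]; exact: pos.
Qed.
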